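(* Let $\mathsf{q}=(q:E\to M,+_q,0_q,\lambda)$ be a differential bundle in a tangent category. To have a Finsler connection on $\mathsf{q}$ is precisely to have a vertical connection on $\mathsf{q}$. That is, if $R:T(E)\to E_2$ is a Finsler connection then $R\pi_0:T(E)\to E$ is a vertical connection, and conversely, if $K:T(E)\to E$ is a vertical connection then $\langle K,p\rangle:T(E)\to E_2$ is a Finsler connection, and these translations are inverse to each other.
   Context: Conventions: composites are written in diagrammatic order ($fg$ means first $f$, then $g$). $\langle f,g\rangle$ is the induced map into a pullback, $\pi_0,\pi_1$ are projections, $h\times k=\langle\pi_0h,\pi_1k\rangle$ between pullbacks. Component subscripts of natural transformations are often omitted. An additive bundle over $M$ is a map $q:E\to M$ whose finite wide pullbacks $E_n$ along itself exist, with maps $+_q:E_2\to E$, $0_q:M\to E$ making $q$ a commutative monoid in the slice over $M$. An additive bundle morphism $(f_1,f_0)$ from $q:E\to M$ to $q':E'\to M'$ is a pair $f_1:E\to E'$, $f_0:M\to M'$ with $f_1q'=qf_0$ preserving addition and zero. A tangent category is a category with a functor $T$ and natural transformations $p:T\to 1$, $0:1\to T$, $+:T_2\to T$, $\ell:T\to T^2$, $c:T^2\to T^2$ such that: each $(p_M,+_M,0_M)$ is an additive bundle, the wide pullbacks $T_nM$ of $p_M$ exist and are preserved by each $T^k$; $(\ell_M,0_M)$ is an additive bundle morphism from $(p_M,+_M,0_M)$ to $(T(p_M),T(+_M),T(0_M))$; $(c_M,1)$ is an additive bundle morphism from $(T(p_M),T(+_M),T(0_M))$ to $(p_{TM},+_{TM},0_{TM})$;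 $c^2=1$, $\ell c=\ell$, $\ell_M\ell_{TM}=\ell_MT(\ell_M)$, $T(c)cT(c)=cT(c)c$, $\ell_{TM}T(c_M)c_{TM}=c_MT(\ell_M)$; and the square with top $\langle\pi_0\ell,\pi_10\rangle T(+):T_2M\to T^2M$, left $\pi_0p=\pi_1p$, right $T(p)$, bottom $0_M$ is a pullback preserved by each $T^k$. A differential bundle $\mathsf{q}=(q:E\to M,+_q,0_q,\lambda)$ is an additive bundle with a lift $\lambda:E\to T(E)$ such that: the wide pullbacks $E_n$ are preserved by each $T^k$; for all $n,m$ the pullback of $E_n\to M$ along $T_mM\to M$ exists and is preserved by each $T^k$; $(\lambda,0_M)$ is an additive bundle morphism from $q$ to $(T(q),T(+_q),T(0_q))$; $(\lambda,0_q)$ is an additive bundle morphism from $q$ to $(p_E,+_E,0_E)$; with $\mu:=\langle\pi_0\lambda,\pi_10\rangle T(+_q):E_2\to T(E)$, the square with top $\mu$, left $\pi_0q=\pi_1q:E_2\to M$, right $T(q)$, bottom $0_M$ is a pullback (preserved by each $T^k$); and $\lambda\ell_E=\lambda T(\lambda)$. A linear bundle morphism $(f_1,f_0)$ between differential bundles is a pair with $f_1q'=qf_0$ and $f_1\lambda'=\lambda T(f_1)$; such a morphism is automatically additive. The bundle $\mathsf{p}_E$ is $p_E:T(E)\to E$ with lift $\ell_E$; the bundle $T(\mathsf{q})$ is $T(q):T(E)\to T(M)$ with lift $T(\lambda)c$. A vertical connection on $\mathsf{q}$ is a map $K:T(E)\to E$ with $\lambda K=1_E$ such that $(K,p_M):T(\mathsf{q})\to\mathsf{q}$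 and $(K,q):\mathsf{p}_E\to\mathsf{q}$ are linear bundle morphisms; equivalently $\lambda K=1_E$, $Kq=pq$, $K\lambda=\ell T(K)$, $K\lambda=T(\lambda)cT(K)$. The bundle $q^*(\mathsf{q})$ (pullback of $\mathsf{q}$ along $q$) is $\pi_1:E_2\to E$ with lift $\langle\pi_0\lambda,\pi_10\rangle:E_2\to T(E_2)$. The bundle $0^*(T(\mathsf{q}))$ (pullback of $T(\mathsf{q})$ along $0_M:M\to T(M)$, using the pullback square of $\mu$) is $\pi_0q:E_2\to M$ with lift the unique $\lambda_2:E_2\to T(E_2)$ such that $\lambda_2T(\pi_0q)=\pi_0q0$ and $\lambda_2T(\mu)=\mu T(\lambda)c$. A Finsler connection on $\mathsf{q}$ is a map $R:T(E)\to E_2$ such that $\mu R=1_{E_2}$, $(R,p_M):T(\mathsf{q})\to0^*(T(\mathsf{q}))$ is a linear bundle morphism, and $(R,1_E):\mathsf{p}_E\to q^*(\mathsf{q})$ is a linear bundle morphism. *)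

(* Defs.v *)
From mathcomp Require Import all_boot.

Set Implicit Arguments.
Unset Strict Implicit.
Unset Printing Implicit Defensive.

Declare Scope cat_scope.
Delimit Scope cat_scope with cat.
Local Open Scope cat_scope.

Record Category := {
  Ob :> Type;
  Hom : Ob -> Ob -> Type;
  idm : forall X, Hom X X;
  comp : forall X Y Z, Hom X Y -> Hom Y Z -> Hom X Z;
  comp1m : forall X Y (f : Hom X Y), comp (idm X) f = f;
  compm1 : forall X Y (f : Hom X Y), comp f (idm Y) = f;
  compA : forall X Y Z W (f : Hom X Y) (g : Hom Y Z) (h : Hom Z W),
    comp f (comp g h) = comp (comp f g) h
}.

(* Composition is diagrammatic: [f ;; g] is first [f], then [g]. *)
Notation "f ;; g" := (comp f g) (at level 50, left associativity) : cat_scope.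

Record Functor (C D : Category) := {
  fobj :> C -> D;
  fmap : forall X Y : C, Hom X Y -> Hom (fobj X) (fobj Y);
  fmap1 : forall X : C, fmap (idm X) = idm (fobj X);
  fmapM : forall (X Y Z : C) (f : Hom X Y) (g : Hom Y Z),
    fmap (f ;; g) = fmap f ;; fmap g
}.

Arguments fmap {C D} F {X Y} f : rename.

Definition fid (C : Category) : Functor C C :=
  {| fobj := fun X => X; fmap := fun X Y f => f;
     fmap1 := fun X => erefl; fmapM := fun X Y Z f g => erefl |}.

Lemma fcomp_fmap1 (C D B : Category) (F : Functor C D) (G : Functor D B)
  (X : C) : fmap G (fmap F (idm X)) = idm (G (F X)).
Proof. by rewrite !fmap1. Qed.

Lemma fcomp_fmapM (C D B : Category) (F : Functor C D) (G : Functor D B)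
  (X Y Z : C) (f : Hom X Y) (g : Hom Y Z) :
  fmap G (fmap F (f ;; g)) = fmap G (fmap F f) ;; fmap G (fmap F g).
Proof. by rewrite !fmapM. Qed.

Definition fcomp (C D B : Category) (F : Functor C D) (G : Functor D B) :
  Functor C B :=
  {| fobj := fun X => G (F X); fmap := fun X Y f => fmap G (fmap F f);
     fmap1 := fcomp_fmap1 F G; fmapM := fcomp_fmapM F G |}.

Fixpoint fpow (C : Category) (F : Functor C C) (k : nat) : Functor C C :=
  if k is k'.+1 then fcomp (fpow F k') F else fid C.

Record NatTrans (C D : Category) (F G : Functor C D) := {
  ntc :> forall X : C, Hom (F X) (G X);
  ntE : forall (X Y : C) (f : Hom X Y), ntc X ;; fmap G f = fmap F f ;; ntc Y
}.

(* A universal property is given by a function returning the mediating map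
   together with its uniqueness, so these records live in [Type]; any two
   witnesses have the same mediating maps. *)

(*      P --p0--> A
        |         |
       p1         f
        v         v
        B --g-->  D      *)
Record IsPullback (C : Category) (A B D P : C) (f : Hom A D) (g : Hom B D)
    (p0 : Hom P A) (p1 : Hom P B) := {
  pb_comm : p0 ;; f = p1 ;; g;
  pb_lift : forall (X : C) (a : Hom X A) (b : Hom X B),
    a ;; f = b ;; g -> Hom X P;
  pb_lift0 : forall (X : C) (a : Hom X A) (b : Hom X B) (e : a ;; f = b ;; g),
    pb_lift e ;; p0 = a;
  pb_lift1 : forall (X : C) (a : Hom X A) (b : Hom X B) (e : a ;; f = b ;; g),
    pb_lift e ;; p1 = b;
  pb_uniq : forall (X : C) (h h' : Hom X P),
    h ;; p0 = h' ;; p0 -> h ;; p1 = h' ;; p1 -> h = h'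
}.

Definition PreservesPullback (C C' : Category) (F : Functor C C')
    (A B D P : C) (f : Hom A D) (g : Hom B D) (p0 : Hom P A) (p1 : Hom P B) :=
  IsPullback (fmap F f) (fmap F g) (fmap F p0) (fmap F p1).

Record Pullback (C : Category) (A B D : C) (f : Hom A D) (g : Hom B D) := {
  pb_obj :> C;
  pb_pr0 : Hom pb_obj A;
  pb_pr1 : Hom pb_obj B;
  pb_is : IsPullback f g pb_pr0 pb_pr1
}.

(* The [n]-fold wide pullback of [q] along itself, as a limit cone with legs
   [proj i] and [base]; the leg [base] matters only for [n = 0], where the
   limit is [M] itself. *)
Record IsWidePullback (C : Category) (n : nat) (E M P : C) (q : Hom E M)
    (base : Hom P M) (proj : 'I_n -> Hom P E) := {
  wpb_comm : forall i, proj i ;; q = base;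
  wpb_lift : forall (X : C) (b : Hom X M) (f : 'I_n -> Hom X E),
    (forall i, f i ;; q = b) -> Hom X P;
  wpb_lift_base : forall (X : C) (b : Hom X M) (f : 'I_n -> Hom X E)
    (e : forall i, f i ;; q = b), wpb_lift e ;; base = b;
  wpb_lift_proj : forall (X : C) (b : Hom X M) (f : 'I_n -> Hom X E)
    (e : forall i, f i ;; q = b) i, wpb_lift e ;; proj i = f i;
  wpb_uniq : forall (X : C) (h h' : Hom X P),
    h ;; base = h' ;; base -> (forall i, h ;; proj i = h' ;; proj i) -> h = h'
}.

Record WidePullback (C : Category) (n : nat) (E M : C) (q : Hom E M) := {
  wp_obj :> C;
  wp_base : Hom wp_obj M;
  wp_proj : 'I_n -> Hom wp_obj E;
  wp_is : IsWidePullback q wp_base wp_proj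
}.

Definition PreservesWidePullback (C C' : Category) (F : Functor C C') (n : nat)
    (E M : C) (q : Hom E M) (W : WidePullback n q) :=
  IsWidePullback (fmap F q) (fmap F (wp_base W)) (fun i => fmap F (wp_proj W i)).

Definition image_wp (C C' : Category) (F : Functor C C') (n : nat)
    (E M : C) (q : Hom E M) (W : WidePullback n q)
    (H : PreservesWidePullback F W) : WidePullback n (fmap F q) :=
  {| wp_obj := F W; wp_base := fmap F (wp_base W);
     wp_proj := fun i => fmap F (wp_proj W i); wp_is := H |}.

Notation pr W k := (wp_proj W (@Ordinal 2 k isT)).

Section FibrePowers.
Variable C : Category.

Lemma pr_q (n : nat) (E M : C) (q : Hom E M) (W : WidePullback n q) i j :
  wp_proj W i ;; q = wp_proj W j ;; q.
Proof. by rewrite !(wpb_comm (wp_is W)). Qed.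

Definition fam2 (X E : C) (f g : Hom X E) (i : 'I_2) : Hom X E :=
  if (i : nat) is 0 then f else g.

Lemma fam2_q (X E M : C) (q : Hom E M) (f g : Hom X E) (e : f ;; q = g ;; q) i :
  fam2 f g i ;; q = f ;; q.
Proof. by rewrite /fam2; case: (i : nat). Qed.

(* The pairing <f, g> into a binary fibre power. *)
Definition pair2 (E M : C) (q : Hom E M) (W : WidePullback 2 q)
    (X : C) (f g : Hom X E) (e : f ;; q = g ;; q) : Hom X W :=
  wpb_lift (wp_is W) (fam2_q e).

Lemma pair2_0 (E M : C) (q : Hom E M) (W : WidePullback 2 q)
    (X : C) (f g : Hom X E) (e : f ;; q = g ;; q) :
  pair2 W e ;; pr W 0 = f.
Proof. by rewrite /pair2 wpb_lift_proj. Qed.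

Lemma pair2_1 (E M : C) (q : Hom E M) (W : WidePullback 2 q)
    (X : C) (f g : Hom X E) (e : f ;; q = g ;; q) :
  pair2 W e ;; pr W 1 = g.
Proof. by rewrite /pair2 wpb_lift_proj. Qed.

Lemma pair2_uniq (E M : C) (q : Hom E M) (W : WidePullback 2 q)
    (X : C) (h h' : Hom X W) :
  h ;; pr W 0 = h' ;; pr W 0 -> h ;; pr W 1 = h' ;; pr W 1 -> h = h'.
Proof.
move=> e0 e1; apply: (wpb_uniq (h := h) (h' := h') (wp_is W)).
  by rewrite -(wpb_comm (wp_is W) (@Ordinal 2 0 isT)) !compA e0.
by case=> -[|[|//]] lt_i; [move: e0 | move: e1]; rewrite !(bool_irrelevance lt_i isT).
Qed.

Lemma square_pr (E M E' M' : C) (q : Hom E M) (q' : Hom E' M')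
    (f1 : Hom E E') (f0 : Hom M M') (n : nat) (W : WidePullback n q)
    (e : f1 ;; q' = q ;; f0) i :
  (wp_proj W i ;; f1) ;; q' = wp_base W ;; f0.
Proof. by rewrite -compA e compA (wpb_comm (wp_is W)). Qed.

(* The map E_n -> E'_n induced by a commuting square; for n = 2 it is
   f1 x f1 = <pi_0 f1, pi_1 f1>. *)
Definition fibre_pow_map (E M E' M' : C) (q : Hom E M) (q' : Hom E' M')
    (f1 : Hom E E') (f0 : Hom M M') (n : nat)
    (W : WidePullback n q) (W' : WidePullback n q')
    (e : f1 ;; q' = q ;; f0) : Hom W W' :=
  wpb_lift (wp_is W') (square_pr W e).

Lemma plus_left_q (E M : C) (q : Hom E M) (W2 : WidePullback 2 q)
    (W3 : WidePullback 3 q) (a : Hom W2 E) (ea : a ;; q = pr W2 0 ;; q) i j k :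
  (pair2 W2 (pr_q W3 i j) ;; a) ;; q = wp_proj W3 k ;; q.
Proof. by rewrite -compA ea compA pair2_0; apply: pr_q. Qed.

Lemma unit_q (E M : C) (q : Hom E M) (z : Hom M E) (ez : z ;; q = idm M) :
  idm E ;; q = (q ;; z) ;; q.
Proof. by rewrite -compA ez compm1 comp1m. Qed.

Record AdditiveBundle (E M : C) (q : Hom E M) := {
  ab_pow : forall n, WidePullback n q;
  ab_plus : Hom (ab_pow 2) E;
  ab_zero : Hom M E;
  ab_plus_q : ab_plus ;; q = pr (ab_pow 2) 0 ;; q;
  ab_zero_q : ab_zero ;; q = idm M;
  (* <<pi_0,pi_1>+, pi_2>+ = <pi_0, <pi_1,pi_2>+>+ on E_3 *)
  ab_plusA :
    pair2 (ab_pow 2)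
      (plus_left_q (ab_pow 3) ab_plus_q
         (@Ordinal 3 0 isT) (@Ordinal 3 1 isT) (@Ordinal 3 2 isT))
      ;; ab_plus
    = pair2 (ab_pow 2)
        (esym (plus_left_q (ab_pow 3) ab_plus_q
           (@Ordinal 3 1 isT) (@Ordinal 3 2 isT) (@Ordinal 3 0 isT)))
      ;; ab_plus;
  (* <pi_1,pi_0>+ = + *)
  ab_plusC :
    pair2 (ab_pow 2)
      (pr_q (ab_pow 2) (@Ordinal 2 1 isT) (@Ordinal 2 0 isT)) ;; ab_plus
    = ab_plus;
  (* <1, q0>+ = 1 *)
  ab_plus0 : pair2 (ab_pow 2) (unit_q ab_zero_q) ;; ab_plus = idm E
}.

Record IsAdditiveMorphism (E M E' M' : C) (q : Hom E M) (q' : Hom E' M')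
    (A : AdditiveBundle q) (A' : AdditiveBundle q')
    (f1 : Hom E E') (f0 : Hom M M') : Prop := {
  am_square : f1 ;; q' = q ;; f0;
  am_plus : ab_plus A ;; f1
    = fibre_pow_map (ab_pow A 2) (ab_pow A' 2) am_square ;; ab_plus A';
  am_zero : ab_zero A ;; f1 = f0 ;; ab_zero A'
}.

End FibrePowers.

Section ImageBundle.
Variables (C C' : Category) (F : Functor C C').
Variables (E M : C) (q : Hom E M) (A : AdditiveBundle q).
Variable H : forall n, PreservesWidePullback F (ab_pow A n).

Let W n := image_wp (H n).

Lemma image_pair2 (X : C) (f g : Hom X E) (e : f ;; q = g ;; q)
    (e' : fmap F f ;; fmap F q = fmap F g ;; fmap F q) :
  pair2 (W 2) e' = fmap F (pair2 (ab_pow A 2) e).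
Proof.
apply: pair2_uniq.
  by rewrite pair2_0 /= -fmapM pair2_0.
by rewrite pair2_1 /= -fmapM pair2_1.
Qed.

Lemma pair2_congr (D : Category) (X Y B : D) (r : Hom Y B)
    (V : WidePullback 2 r) (f g f' g' : Hom X Y)
    (e : f ;; r = g ;; r) (e' : f' ;; r = g' ;; r) :
  f = f' -> g = g' -> pair2 V e = pair2 V e'.
Proof. by move=> ef eg; apply: pair2_uniq; rewrite ?pair2_0 ?pair2_1. Qed.

Lemma image_plus_q :
  fmap F (ab_plus A) ;; fmap F q = pr (W 2) 0 ;; fmap F q.
Proof. by rewrite /= -!fmapM ab_plus_q. Qed.

Lemma image_zero_q : fmap F (ab_zero A) ;; fmap F q = idm (F M).
Proof. by rewrite -fmapM ab_zero_q fmap1. Qed.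

Lemma image_pair2_plus (X : C) (f g : Hom X E) (f' g' : Hom (F X) (F E))
    (e : f ;; q = g ;; q) (e' : f' ;; fmap F q = g' ;; fmap F q) :
  f' = fmap F f -> g' = fmap F g ->
  pair2 (W 2) e' ;; fmap F (ab_plus A)
  = fmap F (pair2 (ab_pow A 2) e ;; ab_plus A).
Proof.
move=> ef eg; subst f' g'.
by rewrite (image_pair2 e) -fmapM.
Qed.

Lemma image_plusA :
  pair2 (W 2)
    (plus_left_q (W2 := W 2) (W 3) image_plus_q
       (@Ordinal 3 0 isT) (@Ordinal 3 1 isT) (@Ordinal 3 2 isT))
    ;; fmap F (ab_plus A)
  = pair2 (W 2)
      (esym (plus_left_q (W2 := W 2) (W 3) image_plus_q
         (@Ordinal 3 1 isT) (@Ordinal 3 2 isT) (@Ordinal 3 0 isT)))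
    ;; fmap F (ab_plus A).
Proof.
rewrite (image_pair2_plus (plus_left_q (ab_pow A 3) (ab_plus_q A)
  (@Ordinal 3 0 isT) (@Ordinal 3 1 isT) (@Ordinal 3 2 isT))) //; last first.
  by apply: image_pair2_plus.
rewrite ab_plusA; symmetry; apply: image_pair2_plus => //.
by apply: image_pair2_plus.
Qed.

Lemma image_plusC :
  pair2 (W 2) (pr_q (W 2) (@Ordinal 2 1 isT) (@Ordinal 2 0 isT))
    ;; fmap F (ab_plus A)
  = fmap F (ab_plus A).
Proof.
rewrite -[RHS](congr1 (fmap F) (ab_plusC A)).
by apply: image_pair2_plus.
Qed.

Lemma image_plus0 :
  pair2 (W 2) (unit_q image_zero_q) ;; fmap F (ab_plus A) = idm (F E).
Proof.
rewrite -[RHS]fmap1 -[RHS](congr1 (fmap F) (ab_plus0 A)).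
apply: image_pair2_plus.
  by rewrite fmap1.
by rewrite fmapM.
Qed.

(* The additive bundle (F(q), F(+_q), F(0_q)), with n-fold fibre power F(E_n). *)
Definition image_bundle : AdditiveBundle (fmap F q) :=
  {| ab_pow := W; ab_plus := fmap F (ab_plus A) : Hom (W 2) (F E);
     ab_zero := fmap F (ab_zero A);
     ab_plus_q := image_plus_q; ab_zero_q := image_zero_q;
     ab_plusA := image_plusA; ab_plusC := image_plusC;
     ab_plus0 := image_plus0 |}.

End ImageBundle.

(* mu = <pi_0 l, pi_1 0> T(+); for l = ell_M on p_M this is the map of the
   universality axiom of a tangent category, for l = lambda on q that of a
   differential bundle. *)
Section Mu.
Variables (C : Category) (T : Functor C C) (z : NatTrans (fid C) T).
Variables (E M : C) (q : Hom E M) (A : AdditiveBundle q).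
Variable H : forall n, PreservesWidePullback T (ab_pow A n).
Variables (l : Hom E (T E)) (e : l ;; fmap T q = q ;; z M).

Lemma mu_compat :
  (pr (ab_pow A 2) 0 ;; l) ;; fmap T q = (pr (ab_pow A 2) 1 ;; z E) ;; fmap T q.
Proof.
rewrite -!compA e (ntE z q) /= !compA; congr (_ ;; _).
exact: pr_q.
Qed.

(* <pi_0 l, pi_1 0> : E_2 -> T(E_2) *)
Definition lift_zero : Hom (ab_pow A 2) (T (ab_pow A 2)) :=
  pair2 (image_wp (H 2)) mu_compat.

Definition mu : Hom (ab_pow A 2) (T E) := lift_zero ;; fmap T (ab_plus A).

End Mu.

Record TangentStructure (C : Category) := {
  tanT :> Functor C C;
  tan_p : NatTrans tanT (fid C);
  tan_zero : NatTrans (fid C) tanT;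
  tan_bundle : forall M : C, AdditiveBundle (tan_p M);
  tan_bundle_zero : forall M : C, ab_zero (tan_bundle M) = tan_zero M;
  (* naturality of + : T_2 -> T *)
  tan_plus_nat : forall (M N : C) (f : Hom M N),
    ab_plus (tan_bundle M) ;; fmap tanT f
    = fibre_pow_map (ab_pow (tan_bundle M) 2) (ab_pow (tan_bundle N) 2)
        (esym (ntE tan_p f)) ;; ab_plus (tan_bundle N);
  tan_ell : NatTrans tanT (fcomp tanT tanT);
  tan_c : NatTrans (fcomp tanT tanT) (fcomp tanT tanT);
  tan_pow_preserved : forall (k n : nat) (M : C),
    PreservesWidePullback (fpow tanT k) (ab_pow (tan_bundle M) n);
  tan_ell_additive : forall M : C,
    IsAdditiveMorphism (tan_bundle M)
      (@image_bundle _ _ tanT _ _ _ (tan_bundle M)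
         (fun n => tan_pow_preserved 1 n M))
      (tan_ell M) (tan_zero M);
  tan_c_additive : forall M : C,
    IsAdditiveMorphism
      (@image_bundle _ _ tanT _ _ _ (tan_bundle M)
         (fun n => tan_pow_preserved 1 n M))
      (tan_bundle (tanT M))
      (tan_c M) (idm (tanT M));
  tan_cc : forall M : C, tan_c M ;; tan_c M = idm (tanT (tanT M));
  tan_ell_c : forall M : C, tan_ell M ;; tan_c M = tan_ell M;
  tan_ell_ell : forall M : C,
    tan_ell M ;; tan_ell (tanT M) = tan_ell M ;; fmap tanT (tan_ell M);
  tan_yang_baxter : forall M : C,
    fmap tanT (tan_c M) ;; tan_c (tanT M) ;; fmap tanT (tan_c M)
    = tan_c (tanT M) ;; fmap tanT (tan_c M) ;; tan_c (tanT M);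
  tan_ell_c_c : forall M : C,
    tan_ell (tanT M) ;; fmap tanT (tan_c M) ;; tan_c (tanT M)
    = tan_c M ;; fmap tanT (tan_ell M);
  tan_universal : forall (k : nat) (M : C),
    PreservesPullback (fpow tanT k)
      (fmap tanT (tan_p M)) (tan_zero M)
      (@mu _ tanT tan_zero _ _ _ (tan_bundle M)
         (fun n => tan_pow_preserved 1 n M)
         (tan_ell M) (am_square (tan_ell_additive M)))
      (pr (ab_pow (tan_bundle M) 2) 0 ;; tan_p M)
}.

Record DifferentialBundle (C : Category) (T : TangentStructure C) (E M : C)
    (q : Hom E M) := {
  db_add :> AdditiveBundle q;
  db_lift : Hom E (T E);
  db_pow_preserved : forall k n : nat,
    PreservesWidePullback (fpow T k) (ab_pow db_add n);
  db_pullback : forall n m : nat,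
    Pullback (wp_base (ab_pow db_add n)) (wp_base (ab_pow (tan_bundle T M) m));
  db_pullback_preserved : forall k n m : nat,
    PreservesPullback (fpow T k)
      (wp_base (ab_pow db_add n)) (wp_base (ab_pow (tan_bundle T M) m))
      (pb_pr0 (db_pullback n m)) (pb_pr1 (db_pullback n m));
  db_lift_additive_T :
    IsAdditiveMorphism db_add
      (@image_bundle _ _ T _ _ _ db_add (db_pow_preserved 1))
      db_lift (tan_zero T M);
  db_lift_additive_p :
    IsAdditiveMorphism db_add (tan_bundle T E) db_lift (ab_zero db_add);
  db_universal : forall k : nat,
    PreservesPullback (fpow T k)
      (fmap T q) (tan_zero T M)
      (@mu _ T (tan_zero T) _ _ _ db_add (db_pow_preserved 1)
         db_lift (am_square db_lift_additive_T))
      (pr (ab_pow db_add 2) 0 ;; q);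
  db_lift_lift : db_lift ;; tan_ell T E = db_lift ;; fmap T db_lift
}.

(* Linearity of a bundle morphism refers only to the projection and the lift
   of the source and target differential bundles. *)
Record LiftedBundle (C : Category) (T : TangentStructure C) := {
  lb_tot : C;
  lb_base : C;
  lb_q : Hom lb_tot lb_base;
  lb_lift : Hom lb_tot (T lb_tot)
}.

Definition IsLinear (C : Category) (T : TangentStructure C)
    (B B' : LiftedBundle T) (f1 : Hom (lb_tot B) (lb_tot B'))
    (f0 : Hom (lb_base B) (lb_base B')) : Prop :=
  f1 ;; lb_q B' = lb_q B ;; f0 /\ f1 ;; lb_lift B' = lb_lift B ;; fmap T f1.

Section Connections.
Variables (C : Category) (T : TangentStructure C) (E M : C) (q : Hom E M).
Variable D : DifferentialBundle T q.

Local Notation E2 := (ab_pow D 2).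
Local Notation p := (tan_p T).
Local Notation c := (tan_c T).
Local Notation zero := (tan_zero T).
Local Notation lam := (db_lift D).

Definition db_lift_zero : Hom E2 (T E2) :=
  @lift_zero _ T zero _ _ _ D (db_pow_preserved D 1) lam
    (am_square (db_lift_additive_T D)).

Definition db_mu : Hom E2 (T E) :=
  @mu _ T zero _ _ _ D (db_pow_preserved D 1) lam
    (am_square (db_lift_additive_T D)).

(* The lifted bundles below are, in order, q, p_E, T(q), q^*(q) and, after the
   construction of its lift, 0^*(T(q)). *)
Definition self_bundle : LiftedBundle T := {| lb_q := q; lb_lift := lam |}.

Definition tangent_bundle : LiftedBundle T :=
  {| lb_q := p E : Hom (T E) E; lb_lift := tan_ell T E |}.

Definition T_bundle : LiftedBundle T :=
  {| lb_q := fmap T q; lb_lift := fmap T lam ;; c E |}.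

Definition q_pullback_bundle : LiftedBundle T :=
  {| lb_q := pr E2 1; lb_lift := db_lift_zero |}.

Lemma T_zero_c : fmap T (zero M) ;; c M = zero (T M).
Proof.
have := am_zero (tan_c_additive T M).
by rewrite /= !tan_bundle_zero comp1m.
Qed.

Lemma lambda2_compat :
  (db_mu ;; (fmap T lam ;; c E)) ;; fmap T (fmap T q)
  = ((pr E2 0 ;; q) ;; zero M) ;; fmap T (zero M).
Proof.
have emu : db_mu ;; fmap T q = (pr E2 0 ;; q) ;; zero M.
  exact: (pb_comm (db_universal D 0)).
have elam : (fmap T lam ;; c E) ;; fmap T (fmap T q) = fmap T q ;; zero (T M).
  rewrite -compA (ntE c q) /= compA -fmapM (am_square (db_lift_additive_T D)).
  by rewrite fmapM -compA T_zero_c.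
rewrite -(compA db_mu) elam (compA db_mu) emu -!compA.
by rewrite -(ntE zero (zero M)).
Qed.

(* The unique map E_2 -> T(E_2) with
   lambda_2 T(mu) = mu T(lambda) c and lambda_2 T(pi_0 q) = pi_0 q 0. *)
Definition lambda2 : Hom E2 (T E2) :=
  pb_lift (db_universal D 1) lambda2_compat.

Definition zero_pullback_bundle : LiftedBundle T :=
  {| lb_q := pr E2 0 ;; q; lb_lift := lambda2 |}.

Record IsVerticalConnection (K : Hom (T E) E) : Prop := {
  vc_retract : lam ;; K = idm E;
  vc_linear_T : @IsLinear _ T T_bundle self_bundle K (p M);
  vc_linear_p : @IsLinear _ T tangent_bundle self_bundle K q
}.

Record IsFinslerConnection (R : Hom (T E) E2) : Prop := {
  fc_retract : db_mu ;; R = idm E2;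
  fc_linear_T : @IsLinear _ T T_bundle zero_pullback_bundle R (p M);
  fc_linear_p : @IsLinear _ T tangent_bundle q_pullback_bundle R (idm E)
}.

(* <K, p> *)
Definition vertical_to_finsler (K : Hom (T E) E)
    (hK : IsVerticalConnection K) : Hom (T E) E2 :=
  pair2 E2 (proj1 (vc_linear_p hK) : K ;; q = p E ;; q).

End Connections.

Arguments IsVerticalConnection {C T E M q} D K.
Arguments IsFinslerConnection {C T E M q} D R.
Arguments vertical_to_finsler {C T E M q} D {K} hK.

(* Main.v *)
From Pilot Require Import Defs.
From mathcomp Require Import all_boot.
(* [compA] is to mean associativity of composition in a category. *)
Import Pilot.Defs.

(** A map [R : T E -> E_2] is a pair of maps into [E], and the condition that
[(R, 1)] covers the identity forces the second one to be [p].  So a Finsler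
connection and a vertical connection carry the same datum [K = R pi_0], and it
remains to see that the equations on [R] amount to those on [K], component by
component.  Three facts make this work.

First, [<1, q 0_q> mu = lambda] ([unit_mu]), since adding zero changes
nothing; hence [mu R = 1] gives [lambda K = 1].  Since the universal square of
[mu] makes [mu] monic, [lambda] is monic too ([lift_mono]).

Second, the lift of [0^*(T(q))], given only by a universal property, is
[lambda x lambda] ([lambda2_pr]).  That [lambda x lambda] has the required
composite with [T(mu)] comes down to [lambda l = lambda T(lambda)], [l c = l]
and [T(0) c = 0].  Linearity of [(R, p)] can then be read off in the two
components: the first is linearity of [K], the second naturality of [p].

Third, linear morphisms are additive ([linear_additive]).  This gives
[mu <K, p> = 1]: its first component is [mu K], and [K] being additive
for both bundle structures on [T E], it turns the sum [mu] of [pi_0 lambda]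
and [pi_1 0] into [pi_0 lambda K + pi_1 0 K = pi_0 + 0].  Its second component
[mu p = pi_1] holds in every differential bundle ([mu_p]). *)

Set Implicit Arguments.
Unset Strict Implicit.
Unset Printing Implicit Defensive.

Local Open Scope cat_scope.

(** * Additive bundles and their morphisms *)

Section Additive.
Variable C : Category.

Lemma pow_map_pr (E M E' M' : C) (q : Hom E M) (q' : Hom E' M')
    (f1 : Hom E E') (f0 : Hom M M') (n : nat)
    (W : WidePullback n q) (W' : WidePullback n q')
    (e : f1 ;; q' = q ;; f0) i :
  fibre_pow_map W W' e ;; wp_proj W' i = wp_proj W i ;; f1.
Proof. by rewrite /fibre_pow_map wpb_lift_proj. Qed.

Section Unit.
Variables (E M X : C) (q : Hom E M) (A : AdditiveBundle q).
Variable h : Hom X (ab_pow A 2).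

Lemma plus_zero_r :
  h ;; pr (ab_pow A 2) 1 = h ;; pr (ab_pow A 2) 0 ;; q ;; ab_zero A ->
  h ;; ab_plus A = h ;; pr (ab_pow A 2) 0.
Proof.
move=> e1; rewrite -[RHS]compm1 -(ab_plus0 A) compA.
congr (_ ;; _); apply: pair2_uniq; rewrite -compA ?pair2_0 ?pair2_1 ?compm1 //.
by rewrite e1 !compA.
Qed.

Lemma plus_zero_l :
  h ;; pr (ab_pow A 2) 0 = h ;; pr (ab_pow A 2) 1 ;; q ;; ab_zero A ->
  h ;; ab_plus A = h ;; pr (ab_pow A 2) 1.
Proof.
move=> e0; rewrite -(ab_plusC A) -[RHS]compm1 -(ab_plus0 A) !compA.
congr (_ ;; _); apply: pair2_uniq; rewrite -!compA ?pair2_0 ?pair2_1.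
  by rewrite compm1.
by rewrite e0 !compA.
Qed.

End Unit.

(** The equation of [am_plus] on generalized elements: any [h'] with the right
components may stand for [h] followed by the induced map of fibre powers, so
no compatibility proof has to be matched. *)
Lemma am_plus_elt (E M E' M' X : C) (q : Hom E M) (q' : Hom E' M')
    (A : AdditiveBundle q) (A' : AdditiveBundle q') f1 f0
    (h : Hom X (ab_pow A 2)) (h' : Hom X (ab_pow A' 2)) :
  IsAdditiveMorphism A A' f1 f0 ->
  h' ;; pr (ab_pow A' 2) 0 = h ;; pr (ab_pow A 2) 0 ;; f1 ->
  h' ;; pr (ab_pow A' 2) 1 = h ;; pr (ab_pow A 2) 1 ;; f1 ->
  h ;; ab_plus A ;; f1 = h' ;; ab_plus A'.
Proof.
move=> am e0 e1; rewrite -compA (am_plus am) compA; congr (_ ;; _).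
by apply: pair2_uniq; rewrite -compA pow_map_pr compA.
Qed.

Lemma additive_comp (E1 M1 E2 M2 E3 M3 : C)
    (q1 : Hom E1 M1) (q2 : Hom E2 M2) (q3 : Hom E3 M3)
    (A1 : AdditiveBundle q1) (A2 : AdditiveBundle q2) (A3 : AdditiveBundle q3)
    f1 f0 g1 g0 :
  IsAdditiveMorphism A1 A2 f1 f0 -> IsAdditiveMorphism A2 A3 g1 g0 ->
  IsAdditiveMorphism A1 A3 (f1 ;; g1) (f0 ;; g0).
Proof.
move=> am bm.
have sq : (f1 ;; g1) ;; q3 = q1 ;; (f0 ;; g0).
  by rewrite -compA (am_square bm) compA (am_square am) compA.
exists sq.
  rewrite compA (am_plus am).
  by apply: (am_plus_elt bm); rewrite !pow_map_pr compA.
by rewrite compA (am_zero am) -compA (am_zero bm) compA.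
Qed.

End Additive.

Lemma image_additive (C C' : Category) (F : Functor C C')
    (E M E' M' : C) (q : Hom E M) (q' : Hom E' M')
    (A : AdditiveBundle q) (A' : AdditiveBundle q')
    (H : forall n, PreservesWidePullback F (ab_pow A n))
    (H' : forall n, PreservesWidePullback F (ab_pow A' n)) f1 f0 :
  IsAdditiveMorphism A A' f1 f0 ->
  IsAdditiveMorphism (image_bundle H) (image_bundle H') (fmap F f1) (fmap F f0).
Proof.
move=> am.
have sq : fmap F f1 ;; fmap F q' = fmap F q ;; fmap F f0.
  by rewrite -!fmapM (am_square am).
exists sq; last by rewrite /= -!fmapM (am_zero am).
rewrite /= -fmapM (am_plus am) fmapM; congr (_ ;; _).
apply: (@pair2_uniq _ _ _ _ (image_wp (H' 2)));
  by rewrite [RHS](pow_map_pr (image_wp (H 2)) (image_wp (H' 2)) sq) /= -!fmapM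
    pow_map_pr.
Qed.

(** * Lifts in a tangent category *)

Section Tangent.
Variables (C : Category) (T : TangentStructure C).
Local Notation p := (tan_p T).
Local Notation c := (tan_c T).
Local Notation ell := (tan_ell T).
Local Notation zero := (tan_zero T).

Lemma zero_p (X : C) : zero X ;; p X = idm X.
Proof. by rewrite -tan_bundle_zero ab_zero_q. Qed.

Lemma c_Tp (X : C) : c X ;; fmap T (p X) = p (T X).
Proof.
have := am_square (tan_c_additive T X); rewrite compm1 => <-.
by rewrite compA tan_cc comp1m.
Qed.

Lemma zero_c (X : C) : zero (T X) ;; c X = fmap T (zero X).
Proof. by rewrite -T_zero_c -compA tan_cc compm1. Qed.

Lemma Tmap_additive (X Y : C) (f : Hom X Y) :
  IsAdditiveMorphism (tan_bundle T X) (tan_bundle T Y) (fmap T f) f.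
Proof.
exists (esym (ntE p f)); first exact: tan_plus_nat.
by rewrite !tan_bundle_zero (ntE zero).
Qed.

(** The lift is additive into [T(p)] by definition; the flip carries [T(p)] to
[p_T] and fixes the lift. *)
Lemma ell_additive_p (X : C) :
  IsAdditiveMorphism (tan_bundle T X) (tan_bundle T (T X)) (ell X)
    (ab_zero (tan_bundle T X)).
Proof.
rewrite tan_bundle_zero -(tan_ell_c T X) -[zero X]compm1.
exact: additive_comp (tan_ell_additive T X) (tan_c_additive T X).
Qed.

End Tangent.

(** * Differential bundles *)

Section Differential.
Variables (C : Category) (T : TangentStructure C) (E M : C) (q : Hom E M).
Variable D : DifferentialBundle T q.
Local Notation E2 := (ab_pow D 2).
Local Notation p := (tan_p T).
Local Notation c := (tan_c T).
Local Notation ell := (tan_ell T).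
Local Notation zero := (tan_zero T).
Local Notation lam := (db_lift D).
Local Notation TD := (@image_bundle _ _ T _ _ _ D (db_pow_preserved D 1)).

Lemma T_pair_uniq (X : C) (h h' : Hom X (T E2)) :
  h ;; fmap T (pr E2 0) = h' ;; fmap T (pr E2 0) ->
  h ;; fmap T (pr E2 1) = h' ;; fmap T (pr E2 1) -> h = h'.
Proof. exact: (@pair2_uniq _ _ _ _ (ab_pow TD 2)). Qed.

Lemma TT_pair_uniq (X : C) (h h' : Hom X (T (T E2))) :
  h ;; fmap T (fmap T (pr E2 0)) = h' ;; fmap T (fmap T (pr E2 0)) ->
  h ;; fmap T (fmap T (pr E2 1)) = h' ;; fmap T (fmap T (pr E2 1)) -> h = h'.
Proof. exact: (@pair2_uniq _ _ _ _ (image_wp (db_pow_preserved D 2 2))). Qed.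

Lemma lift_zero_pr0 : db_lift_zero D ;; fmap T (pr E2 0) = pr E2 0 ;; lam.
Proof. exact: (@pair2_0 _ _ _ _ (ab_pow TD 2)). Qed.

Lemma lift_zero_pr1 : db_lift_zero D ;; fmap T (pr E2 1) = pr E2 1 ;; zero E.
Proof. exact: (@pair2_1 _ _ _ _ (ab_pow TD 2)). Qed.

Lemma db_muE : db_mu D = db_lift_zero D ;; fmap T (ab_plus D).
Proof. by []. Qed.

Lemma lift_Tq : lam ;; fmap T q = q ;; zero M.
Proof. exact: (am_square (db_lift_additive_T D)). Qed.

Lemma lift_p : lam ;; p E = q ;; ab_zero D.
Proof. exact: (am_square (db_lift_additive_p D)). Qed.

(** [mu] adds [pi_1 0] to [pi_0 lambda]; on [<1, q 0_q>] the summand [pi_1 0]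
is the zero of [T(q)], by naturality of [0]. *)
Lemma unit_mu : pair2 E2 (unit_q (ab_zero_q D)) ;; db_mu D = lam.
Proof.
set u := pair2 _ _.
have e0 : (u ;; db_lift_zero D) ;; fmap T (pr E2 0) = lam.
  by rewrite -compA lift_zero_pr0 compA pair2_0 comp1m.
rewrite db_muE compA (plus_zero_r (A := TD)); first exact: e0.
have -> : (u ;; db_lift_zero D) ;; pr (ab_pow TD 2) 0 = lam by exact: e0.
rewrite lift_Tq /= -compA lift_zero_pr1 compA pair2_1 -!compA.
by rewrite -(ntE zero (ab_zero D)).
Qed.

Lemma mu_p : db_mu D ;; p E = pr E2 1.
Proof.
have e0 : (db_lift_zero D ;; p E2) ;; pr E2 0 = pr E2 1 ;; q ;; ab_zero D.
  rewrite -compA (ntE p) compA lift_zero_pr0 -compA lift_p compA.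
  by rewrite (pr_q E2 (@Ordinal 2 0 isT) (@Ordinal 2 1 isT)).
have e1 : (db_lift_zero D ;; p E2) ;; pr E2 1 = pr E2 1.
  by rewrite -compA (ntE p) compA lift_zero_pr1 -compA zero_p compm1.
by rewrite db_muE -compA -(ntE p) compA (plus_zero_l (A := D)) ?e1.
Qed.

(** A map [f] is the first component of [f <1, q 0_q>], hence determined by
[f lambda = f <1, q 0_q> mu] and by [f q]; and [f q] is recovered from
[f lambda T(q) = f q 0]. *)
Lemma lift_mono (X : C) (f g : Hom X E) : f ;; lam = g ;; lam -> f = g.
Proof.
move=> efg; set u := pair2 E2 (unit_q (ab_zero_q D)).
have uE h : (h ;; u) ;; pr E2 0 = h :> Hom X E by rewrite -compA pair2_0 compm1.
have efq : f ;; q = g ;; q.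
  rewrite -[f ;; q]compm1 -[g ;; q]compm1 -(zero_p T M) !compA.
  by rewrite -!(compA _ q) -lift_Tq !compA efg.
rewrite -(uE f) -(uE g); congr (_ ;; _).
apply: (pb_uniq (db_universal D 0)).
  by change (f ;; u ;; db_mu D = g ;; u ;; db_mu D); rewrite -!compA unit_mu.
by change (f ;; u ;; (pr E2 0 ;; q) = g ;; u ;; (pr E2 0 ;; q));
  rewrite !compA !uE.
Qed.

(** Additivity of the lift into [p_E], transported by [T] and the flip: this
is the lift of [T(q)]. *)
Lemma T_lift_additive_p :
  IsAdditiveMorphism TD (tan_bundle T (T E)) (fmap T lam ;; c E) (ab_zero TD).
Proof.
rewrite -[ab_zero _]compm1; apply: additive_comp (tan_c_additive T E).
exact: image_additive (db_lift_additive_p D).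
Qed.

(** A linear morphism into a differential bundle is additive.  The zero
section [y] transported by [f1] satisfies [y lambda = y 0], which after [p]
reads [y q 0_q = y].  Sums may be compared after the monic [lambda]; there
[f1] is replaced by [T f1], additive because [+] is natural. *)
Lemma linear_additive (F N : C) (r : Hom F N) (A : AdditiveBundle r)
    (l : Hom F (T F)) (f1 : Hom F E) (f0 : Hom N M) :
  IsAdditiveMorphism A (tan_bundle T F) l (ab_zero A) ->
  f1 ;; q = r ;; f0 -> f1 ;; lam = l ;; fmap T f1 ->
  IsAdditiveMorphism A D f1 f0.
Proof.
move=> ladd sq lin; exists sq.
  have ladd' := additive_comp ladd (Tmap_additive T f1).
  apply: lift_mono.
  rewrite -compA lin (am_plus ladd').
  rewrite (am_plus_elt (db_lift_additive_p D)
    (h' := fibre_pow_map (ab_pow A 2) (ab_pow (tan_bundle T E) 2)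
             (am_square ladd'))) //;
    by rewrite !pow_map_pr -compA lin.
set y := ab_zero A ;; f1.
have yl : y ;; lam = y ;; zero E.
  rewrite -compA lin compA (am_zero ladd) -compA tan_bundle_zero.
  by rewrite (ntE zero) /= compA.
have <- : y ;; q = f0 by rewrite -compA sq compA ab_zero_q comp1m.
by rewrite -compA -lift_p compA yl -compA zero_p compm1.
Qed.

(** The map [lambda x lambda] has the two composites that define the lift of
[0^*(T(q))].  The one with [T(mu)] is compared before the addition [T T (+)],
in the components of [T T E_2]: the first is [lambda l = lambda T(lambda)]
with [l c = l], the second [0 c = T(0)]. *)
Lemma lambda2E :
  exists2 ll : Hom E2 (T E2), lambda2 D = ll &
    (forall i, ll ;; fmap T (wp_proj E2 i) = wp_proj E2 i ;; lam).
Proof.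
pose e := am_square (db_lift_additive_T D).
pose ll : Hom E2 (T E2) := fibre_pow_map E2 (ab_pow TD 2) e.
have llE i : ll ;; fmap T (wp_proj E2 i) = wp_proj E2 i ;; lam.
  exact: (pow_map_pr E2 (ab_pow TD 2) e i).
have plus_lam : ab_plus D ;; lam = ll ;; fmap T (ab_plus D).
  exact: (am_plus (db_lift_additive_T D)).
exists ll => //; apply: (pb_uniq (db_universal D 1)); last first.
  rewrite /lambda2 pb_lift1.
  change ((pr E2 0 ;; q) ;; zero M = ll ;; fmap T (pr E2 0 ;; q)).
  by rewrite fmapM compA llE -compA -lift_Tq compA.
rewrite /lambda2 pb_lift0.
change (db_mu D ;; (fmap T lam ;; c E) = ll ;; fmap T (db_mu D)).
rewrite db_muE fmapM !compA -(compA (db_lift_zero D)) -fmapM plus_lam fmapM.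
rewrite -!compA -(ntE c (ab_plus D)) !compA.
congr (_ ;; _); apply: TT_pair_uniq; rewrite -!compA.
  rewrite (ntE c (pr E2 0)) /= -!fmapM.
  rewrite lift_zero_pr0 !fmapM !compA llE -(compA (db_lift_zero D)) -fmapM llE.
  rewrite fmapM compA lift_zero_pr0 -!compA.
  by congr (_ ;; _); rewrite compA -db_lift_lift -compA tan_ell_c.
rewrite (ntE c (pr E2 1)) /= -!fmapM.
rewrite lift_zero_pr1 !fmapM !compA llE -(compA (db_lift_zero D)) -fmapM llE.
rewrite fmapM compA lift_zero_pr1 -!compA.
by congr (_ ;; _); rewrite compA (ntE zero lam) -compA zero_c.
Qed.

Lemma lambda2_pr i :
  lambda2 D ;; fmap T (wp_proj E2 i) = wp_proj E2 i ;; lam.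
Proof. by case: lambda2E => ll ->. Qed.

(** * The two translations *)

Lemma finsler_to_vertical (R : Hom (T E) E2) :
  IsFinslerConnection D R -> IsVerticalConnection D (R ;; pr E2 0).
Proof.
move=> [muR [/= RqT linT] [/= Rp linp]]; split.
- by rewrite -unit_mu compA -(compA _ (db_mu D)) muR compm1 pair2_0.
- split=> /=; first by rewrite -compA.
  by rewrite fmapM compA -linT -!compA lambda2_pr.
split=> /=; last by rewrite fmapM compA -linp -!compA lift_zero_pr0.
by rewrite -compA RqT -(ntE p).
Qed.

Section Vertical.
Variables (K : Hom (T E) E) (hK : IsVerticalConnection D K).

Lemma vertical_additive_T : IsAdditiveMorphism TD D K (p M).
Proof.
by case: (vc_linear_T hK) => sq lin; apply: linear_additive T_lift_additive_p _ _.
Qed.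

Lemma vertical_additive_p : IsAdditiveMorphism (tan_bundle T E) D K q.
Proof.
case: (vc_linear_p hK) => sq lin.
exact: linear_additive (ell_additive_p T E) _ _.
Qed.

(** Additivity of [(K, p)] splits [mu K] into [pi_0 lambda K = pi_0] and
[pi_1 0 K], the latter zero by additivity of [(K, q)]. *)
Lemma mu_vertical : db_mu D ;; K = pr E2 0.
Proof.
rewrite db_muE.
rewrite (am_plus_elt (h := db_lift_zero D : Hom E2 (ab_pow TD 2))
  (h' := pr E2 0 ;; pair2 E2 (unit_q (ab_zero_q D))) vertical_additive_T).
- by rewrite -compA ab_plus0 compm1.
- rewrite /= lift_zero_pr0 -compA pair2_0.
  by rewrite -(compA _ lam) (vc_retract hK).
rewrite /= lift_zero_pr1 -compA pair2_1 -(compA _ (zero E)) -tan_bundle_zero.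
rewrite (am_zero vertical_additive_p) !compA.
by rewrite (pr_q E2 (@Ordinal 2 0 isT) (@Ordinal 2 1 isT)).
Qed.

Lemma vertical_to_finsler_is_finsler :
  IsFinslerConnection D (vertical_to_finsler D hK).
Proof.
set R := vertical_to_finsler D hK.
have R0 : R ;; pr E2 0 = K by exact: pair2_0.
have R1 : R ;; pr E2 1 = p E by exact: pair2_1.
case: (vc_linear_T hK) (vc_linear_p hK) => /= sqT linT [/= sqp linp].
split.
- by apply: pair2_uniq; rewrite -compA ?R0 ?R1 ?mu_vertical ?mu_p comp1m.
- split=> /=; first by rewrite compA R0.
  apply: T_pair_uniq; rewrite -!compA lambda2_pr -!fmapM ?R0 ?R1 compA.
    by rewrite R0 linT compA.
  by rewrite R1 c_Tp -(ntE p).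
split=> /=; first by rewrite R1 compm1.
apply: T_pair_uniq; rewrite -!compA -fmapM ?R0 ?R1.
  by rewrite lift_zero_pr0 compA R0.
by rewrite lift_zero_pr1 compA R1 (am_square (tan_ell_additive T E)).
Qed.

End Vertical.
End Differential.

Theorem theorem3p40 (C : Category) (T : TangentStructure C) (E M : C)
    (q : Hom E M) (D : DifferentialBundle T q) :
  (forall R : Hom (T E) (ab_pow D 2), IsFinslerConnection D R ->
     IsVerticalConnection D (R ;; pr (ab_pow D 2) 0)) /\
  (forall (K : Hom (T E) E) (hK : IsVerticalConnection D K),
     IsFinslerConnection D (vertical_to_finsler D hK)) /\
  (forall (R : Hom (T E) (ab_pow D 2)), IsFinslerConnection D R ->
     forall hK : IsVerticalConnection D (R ;; pr (ab_pow D 2) 0),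
       vertical_to_finsler D hK = R) /\
  (forall (K : Hom (T E) E) (hK : IsVerticalConnection D K),
     vertical_to_finsler D hK ;; pr (ab_pow D 2) 0 = K).
Proof.
split; first exact: finsler_to_vertical.
split; first exact: vertical_to_finsler_is_finsler.
split=> [R [_ _ [/= Rp _]] hK | K hK]; last exact: pair2_0.
by apply: pair2_uniq; rewrite ?pair2_0 // pair2_1 Rp compm1.
Qed.
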